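(* For the integer-restricted Gaussian field on any finite graph, the variances $$\mathbb E_{A,\lambda}\big[(n_x-n_y)^2\big]$$ are, for all vertices $x,y$, monotone decreasing in the coupling matrix $A$ and in the overall coupling constant $\lambda>0$; that is, $\mathbb E_{A,\lambda}[(n_x-n_y)^2]\le\mathbb E_{A',\lambda'}[(n_x-n_y)^2]$ whenever $A\ge A'$ and $\lambda\ge\lambda'>0$.
   Context: Let $V$ be the finite vertex set of the graph and $\partial V\subset V$ a nonempty boundary set. For a symmetric real matrix $A$ on $\mathbb R^V$ that is positive definite on the subspace of functions vanishing on $\partial V$ (e.g. minus the discrete Laplacian of a connected graph with positive edge weights) and $\lambda>0$, $\mathbb E_{A,\lambda}$ is expectation for the probability measure on functions $n:V\to\mathbb Z$ with $n=0$ on $\partial V$ with weights proportional to $\exp\big(-\frac\lambda2\langle n,An\rangle\big)$. The ordering $A\ge A'$ is that of quadratic forms on the functions vanishing on $\partial V$. ''Decreasing'' means non-increasing. *)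

(* Defs.v *)
From HB Require Import structures.
From mathcomp Require Import all_boot all_order all_algebra.
From mathcomp Require Import all_classical all_reals all_analysis.

Set Implicit Arguments.
Unset Strict Implicit.
Unset Printing Implicit Defensive.

Import Order.TTheory GRing.Theory Num.Theory.

Local Open Scope classical_set_scope.
Local Open Scope ring_scope.

(* [height V] is an alias, so that the countable set Z^V can carry its discrete
   sigma-algebra. *)
Definition height (V : finType) : Type := {ffun V -> int}.

Section height_instances.
Variable V : finType.
Let h0 : height V := [ffun=> 0].
HB.instance Definition _ := Choice.on (height V).
HB.instance Definition _ := isPointed.Build (height V) h0.
HB.instance Definition _ := @isMeasurable.Build default_measure_display
  (height V) discrete_measurable discrete_measurable0
  discrete_measurableC discrete_measurableU.
End height_instances.

Definition vanishes_on (V : finType) (M : nmodType) (B : {set V})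
    (f : V -> M) : Prop := forall x, x \in B -> f x = 0.

(* The quadratic form <f, A f>, the matrix A having its rows and columns indexed
   by the vertices. *)
Definition qform (R : realType) (V : finType) (A : V -> V -> R)
    (f : V -> R) : R := \sum_x f x * (\sum_y A x y * f y).

Definition symmetric_mat (R : realType) (V : finType) (A : V -> V -> R) : Prop :=
  forall x y, A x y = A y x.

Definition posdef_off (R : realType) (V : finType) (B : {set V})
    (A : V -> V -> R) : Prop :=
  forall f : V -> R, vanishes_on B f -> (exists x, f x != 0) -> 0 < qform A f.

Definition qform_le_off (R : realType) (V : finType) (B : {set V})
    (A' A : V -> V -> R) : Prop :=
  forall f : V -> R, vanishes_on B f -> qform A' f <= qform A f.

Section integer_gaussian.
Variables (R : realType) (V : finType) (B : {set V}) (A : V -> V -> R) (l : R).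

Definition gaussian_weight (n : height V) : R :=
  expR (- (l / 2) * qform A (fun x => (n x)%:~R)).

Definition gaussian_mass (S : set (height V)) : \bar R :=
  (\esum_(n in S `&` [set n : height V | vanishes_on B n])
     (gaussian_weight n)%:E)%E.

Let gaussian_mass0 : gaussian_mass set0 = 0%E.
Proof. by rewrite /gaussian_mass set0I esum_set0. Qed.

Let gaussian_mass_ge0 S : (0 <= gaussian_mass S)%E.
Proof. by apply: esum_ge0 => n _; rewrite lee_fin expR_ge0. Qed.

Let gaussian_mass_semi_sigma_additive : semi_sigma_additive gaussian_mass.
Proof.
move=> F _ tF _.
rewrite /gaussian_mass setI_bigcupl esum_bigcupT; last 2 first.
- by apply: trivIset_setIr.
- by move=> n; rewrite lee_fin expR_ge0.
rewrite -nneseries_esumT; last by move=> *; exact: gaussian_mass_ge0.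
by apply: is_cvg_nneseries => *; exact: gaussian_mass_ge0.
Qed.

HB.instance Definition _ := isMeasure.Build _ _ _ gaussian_mass
  gaussian_mass0 gaussian_mass_ge0 gaussian_mass_semi_sigma_additive.

(* The Dirac mass is only the default value [mnormalize] requires. It is not used
   when [posdef_off B A] and [0 < l] hold: the total mass is then positive (the
   zero function has weight 1) and finite. *)
Definition integer_gaussian : probability (height V) R :=
  mnormalize gaussian_mass (dirac (point : height V)).

End integer_gaussian.

(* Main.v *)
Require Import Defs.
From mathcomp Require Import all_boot all_order all_algebra.
From mathcomp Require Import all_classical all_reals all_analysis.
From mathcomp Require Import ring zify.

Import Order.TTheory GRing.Theory Num.Theory.

Local Open Scope ring_scope.

(* Let [w], [w'] be the Gaussian weights of [l A] and [l' A'], and [v] an additive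
   function of the height. Take independent heights [n], [m] of weights [w'], [w]
   and pass to [a = n + m], [b = n - m], which range over the pairs of heights of
   equal parity. Since [v n ^+ 2 - v m ^+ 2 = v a * v b] and the parallelogram law
   applies to both forms,
     [w' n * w m * (v n ^+ 2 - v m ^+ 2) = u a * u b * exp (q a b)],
   where [q = (l A - l' A') / 4] is a nonnegative bilinear form. The kernel
   [exp (q a b)], restricted to pairs of equal parity, is positive semidefinite, so
   the sum over all [n], [m] is nonnegative, which is the inequality between the
   two expectations of [v ^+ 2]. The sums are restricted to boxes, which makes
   every rearrangement finite. *)

(** * Positive semidefinite kernels *)

Definition psd_kernel {R : realType} {T : Type} (K : T -> T -> R) : Prop :=
  forall (s : seq T) (u : T -> R),
    0 <= \sum_(a <- s) \sum_(b <- s) u a * u b * K a b.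

Lemma psd_kernel1 {R : realType} {T : Type} :
  psd_kernel (fun _ _ : T => 1 : R).
Proof.
move=> s u; have -> : \sum_(a <- s) \sum_(b <- s) u a * u b * 1 =
    (\sum_(a <- s) u a) ^+ 2.
  rewrite expr2 mulr_suml; apply: eq_bigr => a _; rewrite mulr_sumr.
  by apply: eq_bigr => b _; rewrite mulr1.
exact: sqr_ge0.
Qed.

(** Schur product theorem with a Gram factor: absorbing [L i] into the coefficients [u] makes each
    [i] an instance of the hypothesis on [K]. *)
Lemma psd_kernelM_gram {R : realType} {T I : Type} (r : seq I)
    (L : I -> T -> R) (K : T -> T -> R) :
  psd_kernel K -> psd_kernel (fun a b => K a b * \sum_(i <- r) L i a * L i b).
Proof.
move=> K0 s u.
under eq_bigr do under eq_bigr do rewrite !mulr_sumr.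
under eq_bigr do rewrite exchange_big.
rewrite exchange_big; apply: sumr_ge0 => i _.
have := K0 s (fun a => u a * L i a); congr (_ <= _).
by apply: eq_bigr => a _; apply: eq_bigr => b _; ring.
Qed.

(** Powers of a Gram kernel are positive semidefinite by the Schur product, and the exponential
    series has nonnegative coefficients; the sign survives the limit of its partial sums. *)
Lemma psd_kernel_expR_gram {R : realType} {T I : Type} (r : seq I)
    (L : I -> T -> R) :
  psd_kernel (fun a b => expR (\sum_(i <- r) L i a * L i b)).
Proof.
set g := fun a b => \sum_(i <- r) L i a * L i b.
have gX k : psd_kernel (fun a b => g a b ^+ k).
  elim: k => [|k IHk]; first exact: psd_kernel1.
  move=> s u; have := psd_kernelM_gram r L _ IHk s u; congr (_ <= _).
  by apply: eq_bigr => a _; apply: eq_bigr => b _; rewrite exprSr.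
move=> s u.
pose S n := \sum_(a <- s) \sum_(b <- s) u a * u b * series (exp_coeff (g a b)) n.
have S0 n : 0 <= S n.
  rewrite /S; under eq_bigr do under eq_bigr do rewrite /series /= mulr_sumr.
  under eq_bigr do rewrite exchange_big.
  rewrite exchange_big; apply: sumr_ge0 => k _.
  have : 0 <= (k`!%:R)^-1 * \sum_(a <- s) \sum_(b <- s) u a * u b * g a b ^+ k.
    by rewrite mulr_ge0 ?invr_ge0 ?ler0n //; exact: gX.
  congr (_ <= _); rewrite mulr_sumr; apply: eq_bigr => a _.
  by rewrite mulr_sumr; apply: eq_bigr => b _; rewrite /exp_coeff /=; ring.
have cvgS : (S n @[n --> \oo] -->
    \sum_(a <- s) \sum_(b <- s) u a * u b * expR (g a b))%classic.
  apply: cvg_big => [|a _]; first exact: add_continuous.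
  apply: cvg_big => [|b _]; first exact: add_continuous.
  by apply: cvgMr; exact: is_cvg_series_exp_coeff.
rewrite -(cvg_lim _ cvgS)//.
by apply: limr_ge; [exact: cvgP cvgS | exact: nearW].
Qed.

(** * Quadratic forms *)

Definition bform {R : realType} {V : finType} (A : V -> V -> R)
    (f g : V -> R) : R :=
  \sum_x f x * (\sum_y A x y * g y).

Section BilinearForm.
Context {R : realType} {V : finType}.
Implicit Types (A : V -> V -> R) (f g h : V -> R).

Lemma qformE A f : qform A f = bform A f f.
Proof. by []. Qed.

Lemma bformC A f g : symmetric_mat A -> bform A f g = bform A g f.
Proof.
move=> symA; rewrite /bform.
under eq_bigr do rewrite mulr_sumr; under [RHS]eq_bigr do rewrite mulr_sumr.
rewrite exchange_big; apply: eq_bigr => y _; apply: eq_bigr => x _.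
by rewrite (symA x y); ring.
Qed.

Lemma bformDl A f g h (t : R) :
  bform A (fun x => f x + t * g x) h = bform A f h + t * bform A g h.
Proof.
rewrite /bform mulr_sumr -big_split; apply: eq_bigr => x _ /=.
by rewrite mulrDl mulrA.
Qed.

Lemma bformDr A f g h (t : R) :
  bform A h (fun x => f x + t * g x) = bform A h f + t * bform A h g.
Proof.
rewrite /bform mulr_sumr -big_split; apply: eq_bigr => x _ /=.
rewrite -(mulrCA (h x)) -mulrDr; congr (_ * _).
rewrite mulr_sumr -big_split; apply: eq_bigr => y _ /=.
by rewrite mulrDr mulrCA.
Qed.

Lemma qformD A f g (t : R) : symmetric_mat A ->
  qform A (fun x => f x + t * g x) =
  qform A f + 2 * t * bform A f g + t ^+ 2 * qform A g.
Proof.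
by move=> symA; rewrite !qformE bformDl !bformDr (bformC A g f symA); ring.
Qed.

Lemma bform_delta A (z : V) g :
  bform A (fun x => (x == z)%:R) g = \sum_y A z y * g y.
Proof.
rewrite /bform (bigD1 z) //= eqxx mul1r [X in _ + X]big1 ?addr0 // => x /negPf ->.
by rewrite mul0r.
Qed.

Lemma qform_delta A (z : V) : qform A (fun x => (x == z)%:R) = A z z.
Proof.
rewrite qformE bform_delta (bigD1 z) //= eqxx mulr1.
by rewrite big1 ?addr0 // => x /negPf ->; rewrite mulr0.
Qed.

(* A form which is nonnegative on the line [g + t f] has nonnegative
   discriminant there. *)
Lemma bform_CauchySchwarz A f g : symmetric_mat A ->
  (forall t : R, 0 <= qform A (fun x => g x + t * f x)) -> 0 <= qform A f ->
  bform A g f ^+ 2 <= qform A f * qform A g.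
Proof.
move=> symA pos; rewrite le_eqVlt => /predU1P[f0|f0]; last first.
  (* This [t] minimises the quadratic polynomial. *)
  have := pos (- bform A g f / qform A f); rewrite qformD //.
  rewrite -(pmulr_rge0 _ f0).
  have -> : qform A f * (qform A g + 2 * (- bform A g f / qform A f) * bform A g f
      + (- bform A g f / qform A f) ^+ 2 * qform A f) =
      qform A f * qform A g - bform A g f ^+ 2 by field; rewrite gt_eqF.
  by rewrite subr_ge0.
rewrite -f0 mul0r; have [->|b0] := eqVneq (bform A g f) 0; first by rewrite expr0n.
(* The form is affine along the line with nonzero slope, so some [t] brings it to -1. *)
have := pos (- (qform A g + 1) / (2 * bform A g f)).
rewrite qformD // -f0 mulr0 addr0.
have -> : qform A g + 2 * (- (qform A g + 1) / (2 * bform A g f)) * bform A g f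
    = -1 by field.
by rewrite oppr_ge0 ler10.
Qed.

(* One step of Gaussian elimination: subtracting the square of the form
   [q z _ / sqrt (q z z)] keeps [q] nonnegative and kills row [z]. *)
Lemma psd_gram (q : V -> V -> R) : symmetric_mat q ->
  (forall f, 0 <= qform q f) ->
  exists s : seq (V -> R), forall x y, q x y = \sum_(f <- s) f x * f y.
Proof.
(* Induction on the number of nonzero diagonal entries. *)
move: {2}_.+1 (ltnSn #|[pred x | q x x != 0]|) => n.
elim: n q => // n IHn q; rewrite ltnS => lt_n symq q0.
have CS z x : q z x ^+ 2 <= q z z * q x x.
  have := bform_CauchySchwarz q (fun y => (y == x)%:R) (fun y => (y == z)%:R) symq
    (fun t => q0 _) (q0 _).
  rewrite !qform_delta bform_delta (bigD1 x) //= eqxx mulr1 big1 ?addr0.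
    by rewrite (mulrC (q x x)).
  by move=> y /negPf ->; rewrite mulr0.
(* A zero diagonal entry kills its row; with a zero diagonal the whole form is zero and the empty
   family works. *)
have q00 z x : q z z = 0 -> q z x = 0.
  move=> zz; apply/eqP; rewrite -sqrf_eq0 eq_le sqr_ge0 andbT.
  by apply: le_trans (CS z x) _; rewrite zz mul0r.
have [z /= nz|diag0] := pickP [pred x | q x x != 0]; last first.
  exists [::] => x y; rewrite big_nil; apply: q00; apply/eqP.
  by have /negbFE := diag0 x.
have qzz : 0 < q z z.
  by rewrite lt_neqAle eq_sym nz -(qform_delta q z) q0.
pose q' x y := q x y - q z x * q z y / q z z.
have [|x y|f|s q'E] := IHn q'.
(* Zero diagonal entries stay zero because their row vanishes, and the entry at [z] becomes zero. *)
- apply: leq_trans lt_n; apply: proper_card; apply/properP; split.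
    apply/fintype.subsetP => x; rewrite !inE; apply: contraNneq => xx.
    by rewrite /q' xx (symq z x) (q00 x z xx) !mul0r subr0.
  exists z; rewrite !inE //= /q' negbK subr_eq0 mulfK //.
- by rewrite /q' (symq x y) (mulrC (q z x)).
(* Completing the square: moving [f] by [- t] at [z] minimises [q] over that coordinate, and the
   minimum is the value of [q'] at [f]. *)
- pose t := (\sum_y q z y * f y) / q z z.
  have := q0 (fun x => f x + (- t) * (x == z)%:R); rewrite qformD //.
  rewrite (bformC q _ _ symq) bform_delta qform_delta; congr (_ <= _).
  set S := \sum_y q z y * f y in t *.
  have row x : \sum_y q' x y * f y = \sum_y q x y * f y - q z x * (S / q z z).
    rewrite mulrA mulrAC mulr_sumr -sumrB; apply: eq_bigr => y _.
    by rewrite /q'; ring.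
  have -> : qform q' f = qform q f - S ^+ 2 / q z z.
    rewrite /qform; under eq_bigr do rewrite row mulrBr.
    rewrite sumrB expr2 -mulrA [in RHS]/S mulr_suml; congr (_ - _).
    by apply: eq_bigr => x _; rewrite -/S; ring.
  rewrite /t; field.
  by rewrite gt_eqF.
exists ((fun x => q z x / Num.sqrt (q z z)) :: s) => x y.
rewrite big_cons -q'E /q'; have := sqr_sqrtr (ltW qzz).
have : Num.sqrt (q z z) != 0 by rewrite sqrtr_eq0 -ltNge.
by move: (Num.sqrt _) => r r0 <-; field.
Qed.

End BilinearForm.

(** * Sums over pairs of heights *)

Lemma ler_sum_subset {R : realType} {T : eqType} (s t : seq T) (F : T -> R) :
  uniq s -> uniq t -> {subset s <= t} -> (forall x, 0 <= F x) ->
  \sum_(x <- s) F x <= \sum_(x <- t) F x.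
Proof.
move=> us ut st F0; rewrite [leRHS](bigID (mem s)) /= -[X in _ <= X + _]big_filter.
rewrite (perm_big [seq x <- t | x \in s]); first by rewrite lerDl sumr_ge0.
apply: uniq_perm => [//||x]; first exact: filter_uniq.
by rewrite mem_filter; apply/idP/andP => [xs|[]//]; split=> //; exact: st.
Qed.

Section SumDifference.
Context {R : realType} {V : finType}.
Implicit Types (n m a b : {ffun V -> int}) (s t : seq {ffun V -> int}).

Definition parity a : {ffun V -> bool} := [ffun x => odd `|a x|%N].

Lemma parity_sumdiff a b :
  parity a = parity b <->
  exists p : {ffun V -> int} * {ffun V -> int}, a = p.1 + p.2 /\ b = p.1 - p.2.
Proof.
split=> [/ffunP ab|[p [-> ->]]]; last first.
  apply/ffunP => x; rewrite !ffunE.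
  by move: (p.1 x : int) (p.2 x : int) => c d; lia.
exists ([ffun x => (a x + b x) %/ 2]%Z, [ffun x => (a x - b x) %/ 2]%Z) => /=.
split; apply/ffunP => x; have := ab x; rewrite !ffunE;
  by move: (a x : int) (b x : int) => c d; lia.
Qed.

(** The change of variables is injective, with the pairs of equal parity as image; the last
    hypothesis makes [t] large enough to hold every preimage of a pair from [s]. *)
Lemma big_sumdiff s t (F : {ffun V -> int} -> {ffun V -> int} -> R) :
  uniq s -> uniq t ->
  (forall n m, n + m \in s -> n - m \in s -> n \in t /\ m \in t) ->
  \sum_(p <- [seq (n, m) | n <- t, m <- t] |
        (p.1 + p.2 \in s) && (p.1 - p.2 \in s)) F (p.1 + p.2) (p.1 - p.2) =
  \sum_(p <- [seq (a, b) | a <- s, b <- s] | parity p.1 == parity p.2)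
     F p.1 p.2.
Proof.
move=> us ut st; pose f p : {ffun V -> int} * {ffun V -> int} :=
  (p.1 + p.2, p.1 - p.2).
have f_inj : injective f.
  move=> [n m] [n' m'] [/ffunP sE /ffunP dE]; congr (_, _); apply/ffunP => x;
    have := sE x; have := dE x; rewrite !ffunE;
    by move: (n x : int) (m x : int) (n' x : int) (m' x : int) => *; lia.
rewrite -[LHS]big_filter -[RHS]big_filter.
rewrite [RHS](perm_big [seq f p | p <- [seq (n, m) | n <- t, m <- t] &
  (p.1 + p.2 \in s) && (p.1 - p.2 \in s)]) ?big_map //=.
apply: uniq_perm => [||[a b]].
- by rewrite filter_uniq // allpairs_uniq // => -[? ?] [].
- by rewrite map_inj_uniq // filter_uniq // allpairs_uniq // => -[? ?] [].
rewrite mem_filter /=; apply/andP/mapP => [[/eqP/parity_sumdiff[p [aE bE]]]|].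
  move=> /allpairsP[[a' b'] /= [as_ bs [aE' bE']]].
  rewrite -aE' aE in as_; rewrite -bE' bE in bs.
  have [nt mt] := st _ _ as_ bs.
  exists p; last by rewrite /f aE bE.
  rewrite mem_filter as_ bs; apply/allpairsP; exists p.
  by split=> //; exact: surjective_pairing.
move=> [p]; rewrite mem_filter => /andP[/andP[as_ bs] _] [aE bE]; split.
  by apply/eqP/parity_sumdiff; exists p.
by apply/allpairsP; exists (a, b); rewrite aE bE.
Qed.

(** The indicator of equal parity is the Gram kernel of the indicators of the parity classes, so the
    Schur product applies. *)
Lemma psd_kernel_parity s (u : {ffun V -> int} -> R) K : psd_kernel K ->
  0 <= \sum_(p <- [seq (a, b) | a <- s, b <- s] | parity p.1 == parity p.2)
         u p.1 * u p.2 * K p.1 p.2.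
Proof.
pose L c a : R := (parity a == c)%:R.
move=> /(psd_kernelM_gram (index_enum {ffun V -> bool}) L)/(_ s u).
congr (_ <= _); rewrite [RHS]big_mkcond big_allpairs; apply: eq_bigr => a _.
apply: eq_bigr => b _ /=; rewrite (bigD1 (parity a)) //= /L eqxx mul1r.
rewrite big1 ?addr0; last by move=> c; rewrite eq_sym => /negPf ->; rewrite mul0r.
by rewrite eq_sym; case: ifP => _; rewrite ?mulr1 ?mulr0.
Qed.

(* Exchanging [n] and [m] in the left-hand product turns the difference of both
   sides into a sum of [w' n * w m * (v n ^+ 2 - v m ^+ 2)]; in the variables
   [n + m] and [n - m], which range over all pairs of equal parity, this is a
   positive semidefinite kernel. *)
Lemma weighted_sum_cross (r s t : seq {ffun V -> int})
    (w w' v u : {ffun V -> int} -> R) K :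
  uniq r -> uniq s -> uniq t -> {subset r <= t} ->
  (forall n m, n \in r -> m \in r -> n + m \in s /\ n - m \in s) ->
  (forall n m, n + m \in s -> n - m \in s -> n \in t /\ m \in t) ->
  (forall n, n \in s -> - n \in s) ->
  (forall n, 0 <= w n) -> (forall n, 0 <= w' n) ->
  psd_kernel K ->
  (forall n m, n \in t -> m \in t ->
     w' n * w m * (v n ^+ 2 - v m ^+ 2) = u (n + m) * u (n - m) * K (n + m) (n - m)) ->
  (\sum_(n <- r) v n ^+ 2 * w n) * (\sum_(n <- r) w' n) <=
  (\sum_(n <- t) v n ^+ 2 * w' n) * (\sum_(n <- t) w n).
Proof.
move=> ur us ut rt rs st sN w0 w'0 K0 wE.
(* Pairs on which the change of variables is exact. All terms are nonnegative, so the left side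
   grows to this region and the right side shrinks to it. *)
pose G (p : {ffun V -> int} * {ffun V -> int}) :=
  (p.1 + p.2 \in s) && (p.1 - p.2 \in s).
pose sq (l : seq {ffun V -> int}) := [seq (n, m) | n <- l, m <- l].
have usq l : uniq l -> uniq (sq l) by move=> ul; rewrite allpairs_uniq // => -[? ?] [].
have prodE l (f g : {ffun V -> int} -> R) :
    (\sum_(n <- l) f n) * (\sum_(n <- l) g n) = \sum_(p <- sq l) f p.1 * g p.2.
  by rewrite big_allpairs mulr_suml; apply: eq_bigr => n _; rewrite mulr_sumr.
rewrite !prodE.
have GC n m : G (n, m) = G (m, n).
  by rewrite /G /= addrC; congr (_ && _); apply/idP/idP => /sN; rewrite opprB.
apply: (@le_trans _ _ (\sum_(p <- sq t | G p) v p.1 ^+ 2 * w p.1 * w' p.2)).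
  rewrite -[leRHS]big_filter; apply: ler_sum_subset.
  - exact: usq.
  - by rewrite filter_uniq // usq.
  - move=> [n m] /allpairsP[[n' m'] /= [nr mr [-> ->]]].
    have [ns ms] := rs _ _ nr mr.
    rewrite mem_filter /G /= ns ms; apply/allpairsP; exists (n', m').
    by split=> //; exact: rt.
  - by move=> p; rewrite mulr_ge0 ?(mulr_ge0 (sqr_ge0 _)).
apply: (@le_trans _ _ (\sum_(p <- sq t | G p) v p.1 ^+ 2 * w' p.1 * w p.2)); last first.
  rewrite [leRHS](bigID G) /= lerDl sumr_ge0 // => p _.
  by rewrite mulr_ge0 ?(mulr_ge0 (sqr_ge0 _)).
have -> : \sum_(p <- sq t | G p) v p.1 ^+ 2 * w p.1 * w' p.2 =
    \sum_(p <- sq t | G p) v p.2 ^+ 2 * w p.2 * w' p.1.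
  rewrite big_mkcond [RHS]big_mkcond /= !big_allpairs exchange_big.
  by apply: eq_bigr => m _; apply: eq_bigr => n _; rewrite GC.
rewrite -subr_ge0 -sumrB.
rewrite big_seq_cond (eq_bigr (fun p =>
  u (p.1 + p.2) * u (p.1 - p.2) * K (p.1 + p.2) (p.1 - p.2))); last first.
  move=> [n m] /andP[/allpairsP[[n' m'] /= [nt mt [-> ->]]] _].
  by rewrite -wE //; ring.
by rewrite -big_seq_cond (big_sumdiff s t (fun a b => u a * u b * K a b)) //;
  exact: psd_kernel_parity.
Qed.

End SumDifference.

(** * Boxes *)

Section Box.
Context {V : finType}.
Implicit Types (B : {set V}) (n m : {ffun V -> int}).

(** Encoding by functions into an ordinal gives the cube an enumeration over which a product of sums
    can be distributed. *)
Definition box_point (N : nat) (t : {ffun V -> 'I_(N + N).+1}) : {ffun V -> int} :=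
  [ffun x => (t x)%:Z - N%:Z].

Definition box B (N : nat) : seq {ffun V -> int} :=
  [seq n : {ffun V -> int} <- [seq box_point N t | t : {ffun V -> 'I_(N + N).+1}] |
     [forall x in B, n x == 0]].

Lemma mem_box B N n :
  (n \in box B N) = [forall x in B, n x == 0] && [forall x, (`|n x| <= N)%N].
Proof.
rewrite mem_filter; congr (_ && _); apply/fintype.imageP/forallP => [[t _ ->] x|nN].
  rewrite ffunE; have := ltn_ord (t x).
  by move: (nat_of_ord (t x)) => k; lia.
exists [ffun x => inord `|(n x + N%:Z)%R|%N] => //; apply/ffunP => x.
by rewrite !ffunE inordK; have := nN x; move: (n x : int) => k; lia.
Qed.

Lemma box_uniq B N : uniq (box B N).
Proof.
rewrite filter_uniq // map_inj_uniq ?enum_uniq // => s t /ffunP st.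
by apply/ffunP => x; apply: val_inj; have := st x; rewrite !ffunE /=; lia.
Qed.

Lemma box_vanishes_on B N n : n \in box B N -> vanishes_on B n.
Proof. by rewrite mem_box => /andP[/forall_inP nB _] x /nB/eqP. Qed.

Lemma sub_box B N M : (N <= M)%N -> {subset box B N <= box B M}.
Proof.
move=> NM n; rewrite !mem_box => /andP[-> /forallP nN]; apply/forallP => x.
exact: leq_trans (nN x) NM.
Qed.

Lemma box_sumdiff B N n m : n \in box B N -> m \in box B N ->
  n + m \in box B (N + N) /\ n - m \in box B (N + N).
Proof.
rewrite !mem_box => /andP[/forall_inP nB /forallP nN].
move=> /andP[/forall_inP mB /forallP mN].
split; apply/andP;
  (split; [apply/forall_inP => x /[dup] /nB/eqP + /mB/eqP
          | apply/forallP => x; move: (nN x) (mN x)]);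
  by rewrite !ffunE; move: (n x : int) (m x : int) => *; lia.
Qed.

(** Both [2 n] and [2 m] are a sum or difference of two heights in the box, so after halving the
    same [N] bounds them. *)
Lemma box_sumdiff_inv B N n m : n + m \in box B N -> n - m \in box B N ->
  n \in box B N /\ m \in box B N.
Proof.
rewrite !mem_box => /andP[/forall_inP sB /forallP sN].
move=> /andP[/forall_inP dB /forallP dN].
split; apply/andP;
  (split; [apply/forall_inP => x /[dup] /sB/eqP + /dB/eqP
          | apply/forallP => x; move: (sN x) (dN x)]);
  by rewrite !ffunE; move: (n x : int) (m x : int) => *; lia.
Qed.

Lemma boxN B N n : n \in box B N -> - n \in box B N.
Proof.
rewrite !mem_box => /andP[/forall_inP nB /forallP nN]; apply/andP; split.
  by apply/forall_inP => x /nB; rewrite !ffunE oppr_eq0.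
by apply/forallP => x; have := nN x; rewrite !ffunE; move: (n x : int) => *; lia.
Qed.

Lemma sub_seq_box B (s : seq {ffun V -> int}) :
  (forall n, n \in s -> vanishes_on B n) -> exists N, {subset s <= box B N}.
Proof.
elim: s => [|n s IHs] sB; first by exists 0.
have [m ms|N sN] := IHs; first by apply: sB; rewrite inE ms orbT.
exists (N + \sum_x `|n x|)%N => m; rewrite inE => /predU1P[->|/sN].
  rewrite mem_box; apply/andP; split.
    by apply/forall_inP => x xB; rewrite (sB n) // inE eqxx.
  by apply/forallP => x; rewrite (bigD1 x) //=; lia.
by apply: sub_box; rewrite leq_addr.
Qed.

(** Two geometric series, one on each side of [N]. *)
Lemma sum_expr_dist_le {R : realType} (q : R) N : 0 <= q < 1 ->
  \sum_(k < (N + N).+1) q ^+ `|k%:Z - N%:Z|%N <= 2 / (1 - q).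
Proof.
move=> /andP[q0 q1].
have geo M : \sum_(k < M) q ^+ k <= (1 - q)^-1.
  have qM : (1 - q) * \sum_(k < M) q ^+ k = 1 - q ^+ M.
    by rewrite -[in RHS](expr1n _ M) subrXX; congr (_ * _); apply: eq_bigr => i _;
      rewrite expr1n mul1r.
  rewrite -[leRHS]div1r ler_pdivlMr ?subr_gt0 // mulrC qM.
  by rewrite gerBl exprn_ge0.
rewrite -addnS big_split_ord /= mulr_natl mulr2n; apply: lerD.
  apply: le_trans (geo N); rewrite (reindex_inj rev_ord_inj) /=.
  apply: ler_sum => i _.
  have -> : `|((N - i.+1)%N%:Z - N%:Z)%R|%N = i.+1.
    by have := ltn_ord i; move: (nat_of_ord i) => k; lia.
  by rewrite exprS ler_piMl ?exprn_ge0 // ltW.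
apply: le_trans (geo N.+1); apply: ler_sum => i _.
by rewrite PoszD addrAC subrr add0r absz_nat.
Qed.

(** Forgetting the condition on [B] leaves the full cube, where the sum factorises over the
    vertices. *)
Lemma sum_box_le {R : realType} B N (F : V -> int -> R) :
  (forall x k, 0 <= F x k) ->
  \sum_(n <- box B N) \prod_x F x (n x) <=
  \prod_x \sum_(k < (N + N).+1) F x (k%:Z - N%:Z).
Proof.
move=> F0; rewrite bigA_distr_bigA /= /box big_filter big_mkcond big_image /=.
apply: ler_sum => t _.
have -> : \prod_x F x (box_point N t x) = \prod_x F x ((t x)%:Z - N%:Z).
  by apply: eq_bigr => x _; rewrite ffunE.
by case: ifP => // _; exact: prodr_ge0.
Qed.

End Box.

(** * Finiteness of the partition function *)

Section Coercivity.
Context {R : realType} {V : finType} (B : {set V}) (A : V -> V -> R).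
Hypotheses (symA : symmetric_mat A) (posA : posdef_off B A).
Implicit Types f g h : V -> R.

Lemma qform_eq0 f : (forall x, f x = 0) -> qform A f = 0.
Proof. by move=> f0; rewrite /qform big1 // => x _; rewrite f0 mul0r. Qed.

Lemma posdef_off_eq0 f : vanishes_on B f -> qform A f = 0 -> forall x, f x = 0.
Proof.
move=> fB f0 x; apply: contrapT => /eqP fx.
by have := posA f fB (ex_intro _ x fx); rewrite f0 ltxx.
Qed.

Lemma posdef_off_ge0 f : vanishes_on B f -> 0 <= qform A f.
Proof.
move=> fB; have [f0|] := pselect (forall x, f x = 0); first by rewrite qform_eq0.
by move=> /existsNP[x /eqP fx]; rewrite ltW // posA //; exists x.
Qed.

(* The matrix which acts as [A] on the functions vanishing on [B] and as the
   identity on [B]. *)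
Let M : 'M[R]_#|V| := \matrix_(i, j)
  if enum_val i \in B then (i == j)%:R
  else if enum_val j \in B then 0 else A (enum_val i) (enum_val j).

Let row_of h : 'rV[R]_#|V| := \row_i h (enum_val i).

Lemma row_of_mulM h y : (row_of h *m M) 0 (enum_rank y) =
  if y \in B then h y else \sum_(x | x \notin B) h x * A x y.
Proof.
rewrite mxE (reindex (@enum_rank V)) /=; last exact/onW_bij/enum_rank_bij.
under eq_bigr do rewrite !mxE !enum_rankK (inj_eq enum_rank_inj).
case: ifP => yB.
  rewrite (bigD1 y) //= yB eqxx mulr1 big1 ?addr0 // => x /negPf ->.
  by case: ifP => _; rewrite mulr0.
rewrite [RHS]big_mkcond; apply: eq_bigr => x _; case: ifP => //= xB.
by case: eqVneq xB => [->|_ _]; rewrite ?yB ?mulr0.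
Qed.

(** Summing by columns exposes, off [B], the entries of [row_of h *m M]. *)
Lemma bform_vanishes h f : vanishes_on B h ->
  bform A h f = \sum_y f y * \sum_(x | x \notin B) h x * A x y.
Proof.
move=> hB; rewrite /bform; under eq_bigr do rewrite mulr_sumr.
rewrite exchange_big; apply: eq_bigr => y _ /=.
rewrite mulr_sumr [RHS]big_mkcond /=; apply: eq_bigr => x _.
by case: ifPn => [_|/negPn/hB ->]; [ring | rewrite mul0r].
Qed.

Lemma row_of_mulM_vanishes h : vanishes_on B (fun y => (row_of h *m M) 0 (enum_rank y)) ->
  vanishes_on B h.
Proof. by move=> hM y yB; have := hM y yB; rewrite row_of_mulM yB. Qed.

(** A row in the kernel is a function vanishing on [B] whose image under [A] vanishes off [B]; its
    form is zero, so positive definiteness makes it zero. *)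
Lemma dirichlet_unitmx : M \in unitmx.
Proof.
rewrite -row_free_unit; apply: inj_row_free => v vM.
pose h x := v 0 (enum_rank x).
have vE : v = row_of h by apply/rowP => i; rewrite [RHS]mxE /h enum_valK.
have hM y : (row_of h *m M) 0 (enum_rank y) = 0 by rewrite -vE vM mxE.
have hB : vanishes_on B h by apply: row_of_mulM_vanishes => y _.
have h0 : qform A h = 0.
  rewrite qformE bform_vanishes // big1 // => y _.
  have := hM y; rewrite row_of_mulM; case: ifP => [/hB -> _|_ ->]; first exact: mul0r.
  exact: mulr0.
by rewrite vE; apply/rowP => i; rewrite !mxE; exact: posdef_off_eq0.
Qed.

(** [h] is row [z] of the inverse matrix: the Green function of [A] with zero boundary values. *)
Lemma posdef_off_represents z : z \notin B ->
  exists2 h, vanishes_on B h & forall f, vanishes_on B f -> bform A h f = f z.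
Proof.
move=> zB; pose v : 'rV[R]_#|V| := delta_mx 0 (enum_rank z) *m invmx M.
pose h x := v 0 (enum_rank x).
have vE : v = row_of h by apply/rowP => i; rewrite [RHS]mxE /h enum_valK.
have hM y : (row_of h *m M) 0 (enum_rank y) = (y == z)%:R.
  by rewrite -vE /v mulmxKV ?dirichlet_unitmx // mxE eqxx (inj_eq enum_rank_inj).
have hB : vanishes_on B h.
  apply: row_of_mulM_vanishes => y yB; rewrite hM; case: eqP yB => // ->.
  by rewrite (negPf zB).
exists h => // f fB; rewrite bform_vanishes // (bigD1 z) //=.
have := hM z; rewrite row_of_mulM (negPf zB) eqxx => ->.
rewrite mulr1 big1 ?addr0 // => y yz.
have := hM y; rewrite row_of_mulM (negPf yz); case: ifP => [/fB -> _|_ ->].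
  exact: mul0r.
exact: mulr0.
Qed.

(** Cauchy-Schwarz against the Green function at [z] bounds [f z ^+ 2] by a multiple of the form; it
    remains to sum over [z]. *)
Lemma posdef_off_coercive : exists2 c : R, 0 < c &
  forall f, vanishes_on B f -> c * \sum_x f x ^+ 2 <= qform A f.
Proof.
have /choice[k kP] : forall z, exists k, 0 <= k /\
    forall f, vanishes_on B f -> f z ^+ 2 <= k * qform A f.
  move=> z; have [zB|/posdef_off_represents[h hB hE]] := boolP (z \in B).
    by exists 0; split=> // f fB; rewrite fB // expr0n mul0r.
  exists (qform A h); split=> [|f fB]; first exact: posdef_off_ge0.
  rewrite -hE // (bformC A h f symA).
  apply: bform_CauchySchwarz => // [t|]; apply: posdef_off_ge0 => // x xB.
  by rewrite fB // hB // mulr0 addr0.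
have K0 : 0 <= \sum_z k z by apply: sumr_ge0 => z _; case: (kP z).
(* The added 1 keeps the denominator positive even when every [k z] is zero. *)
exists (1 + \sum_z k z)^-1 => [|f fB]; first by rewrite invr_gt0 ltr_wpDr.
rewrite mulrC ler_pdivrMr ?ltr_wpDr // mulrDr mulr1.
apply: (@le_trans _ _ (qform A f * \sum_z k z)).
  by rewrite mulr_sumr; apply: ler_sum => z _; rewrite mulrC; case: (kP z) => _; exact.
by rewrite lerDr posdef_off_ge0.
Qed.

(** Coercivity and [k ^+ 2 >= |k|] for integers dominate the weight by a product of geometric
    weights, whose total is bounded independently of [N]. *)
Lemma sum_box_gaussian_weight_bounded (l : R) : 0 < l ->
  exists C : R, forall N, \sum_(n <- box B N) gaussian_weight A l n <= C.
Proof.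
move=> l0; have [c c0 cA] := posdef_off_coercive.
pose q := expR (- (l / 2 * c)).
have lc0 : 0 < l / 2 * c by rewrite mulr_gt0 // divr_gt0.
have q01 : 0 <= q < 1 by rewrite expR_ge0 expR_lt1 oppr_lt0.
exists (\prod_(x : V) (2 / (1 - q))) => N.
apply: le_trans (_ : \prod_(x : V) \sum_(k < (N + N).+1) q ^+ `|k%:Z - N%:Z|%N <= _).
  apply: le_trans (sum_box_le B N (fun _ k => q ^+ `|k|%N) _); last first.
    by move=> *; rewrite exprn_ge0 // expR_ge0.
  rewrite big_seq [leRHS]big_seq; apply: ler_sum => n /box_vanishes_on nB.
  rewrite /gaussian_weight; under [leRHS]eq_bigr do rewrite -expRM_natl.
  rewrite -expR_sum ler_expR.
  under [leRHS]eq_bigr do rewrite mulrN.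
  rewrite sumrN mulNr lerN2 -mulr_suml.
  apply: (@le_trans _ _ (l / 2 * (c * \sum_x (n x)%:~R ^+ 2))); last first.
    rewrite ler_pM2l ?divr_gt0 //; apply: cA => x xB; by rewrite nB.
  rewrite [leRHS]mulrA mulrC ler_pM2l //; apply: ler_sum => x _.
  have kE (k : int) : k ^+ 2 = (`|k| * `|k|)%N%:Z.
    by rewrite expr2; nia.
  by rewrite -rmorphXn /= kE -pmulrn ler_nat; case: `|n x|%N => // k; rewrite leq_pmulr.
apply: ler_prod => x _; rewrite sum_expr_dist_le // andbT.
by apply: sumr_ge0 => k _; rewrite exprn_ge0 // expR_ge0.
Qed.

End Coercivity.

(** * Expectations as sums *)

Section Expectation.
Context {R : realType} {V : finType} (B : {set V}).

(** Every finite set of heights vanishing on [B] lies in a box, so box sums and the full sum have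
    the same upper bounds. *)
Lemma esum_box_le (a : height V -> R) (C : \bar R) : (forall n, 0 <= a n) ->
  (\esum_(n in [set n : height V | vanishes_on B n]%classic) (a n)%:E <= C)%E <->
  forall N, ((\sum_(n <- box B N) a n)%:E <= C)%E.
Proof.
move=> a0; split=> [aC N|aC].
  apply: le_trans aC; apply: esum_ge; exists [set` (box B N : seq (height V))]%classic.
    by split; [exact: finite_seq | move=> n /box_vanishes_on].
  by rewrite -(fsbig_seq _ (fun n : height V => (a n)%:E) (box_uniq B N)) sumEFin.
apply: ge_ereal_sup => _ [X [Xfin XB] <-]; rewrite fsbig_finite //=.
have [|N XN] := @sub_seq_box V B (finmap.enum_fset (fset_set X)).
  by move=> n; rewrite in_fset_set // inE => /XB.
rewrite sumEFin; apply: le_trans (aC N); rewrite lee_fin.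
by apply: ler_sum_subset => //; [exact: finmap.fset_uniq | exact: box_uniq].
Qed.

(** The space is countable: the fibres of [pickle] cut it into singletons and empty sets. *)
Lemma ge0_integral_height (mu : {measure set (height V) -> \bar R})
    (f : height V -> \bar R) : (forall n, (0 <= f n)%E) ->
  (\int[mu]_n f n = \esum_(n in setT) (f n * mu [set n]%classic))%E.
Proof.
move=> f0; pose F k := [set n : height V | pickle n = k]%classic.
have FU : (\bigcup_k F k = setT)%classic.
  by apply/seteqP; split=> // n _; exists (pickle n).
have tF : trivIset setT F by move=> i j _ _ [n [/= <- <-]].
rewrite -FU ge0_integral_bigcup // nneseries_sum_bigcup //; last first.
  by move=> n; rewrite mule_ge0.
apply: eq_eseriesr => k _.
have [[n nk]|Fk] := pselect (exists n : height V, pickle n = k).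
  have -> : F k = [set n]%classic.
    apply/seteqP; split=> m /=; last by move=> ->.
    by rewrite /F /= -nk => /(pcan_inj pickleK).
  rewrite esum_set1 ?mule_ge0 // -integral_cst //.
  by apply: eq_integral => m /set_mem ->.
have -> : F k = set0 by apply/seteqP; split=> // n nk; apply: Fk; exists n.
by rewrite integral_set0 esum_set0.
Qed.

Context (A : V -> V -> R) (l : R).
Hypotheses (symA : symmetric_mat A) (posA : posdef_off B A) (l0 : 0 < l).

(** The zero height makes [Z] positive and coercivity makes it finite; the last clause describes [Z]
    as the supremum of the box sums. *)
Lemma gaussian_mass_fin : exists2 Z : R,
  0 < Z & gaussian_mass B A l setT = Z%:E /\
  forall C, Z <= C <-> forall N, \sum_(n <- box B N) gaussian_weight A l n <= C.
Proof.
have w0 n : 0 <= gaussian_weight A l n by exact: expR_ge0.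
have le_mass (C : R) : (gaussian_mass B A l setT <= C%:E)%E <->
    forall N, \sum_(n <- box B N) gaussian_weight A l n <= C.
  rewrite /gaussian_mass setTI; apply: iff_trans (esum_box_le _ _ w0) _.
  by split=> wC N; have := wC N; rewrite lee_fin.
have [C0 wC0] := sum_box_gaussian_weight_bounded B A symA posA l l0.
have mass_ge0 : (0 <= gaussian_mass B A l setT)%E by exact: measure_ge0.
have massfin : gaussian_mass B A l setT \is a fin_num.
  by rewrite ge0_fin_numE //; apply: le_lt_trans (iffRL (le_mass C0) wC0) (ltry _).
exists (fine (gaussian_mass B A l setT)); last first.
  rewrite fineK //; split=> // C; rewrite -le_mass -lee_fin fineK //.
apply: (@lt_le_trans _ _ (\sum_(n <- box B 0) gaussian_weight A l n)); last first.
  by apply: (iffLR (le_mass _)); rewrite fineK.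
apply: (@lt_le_trans _ _ (gaussian_weight A l (0 : {ffun V -> int}))).
  exact: expR_gt0.
have := @ler_sum_subset R _ [:: (0 : {ffun V -> int})] (box B 0) (gaussian_weight A l).
rewrite big_seq1; apply=> //; first exact: box_uniq.
move=> n; rewrite inE => /eqP ->; rewrite mem_box; apply/andP; split.
  by apply/forall_inP => x _; rewrite ffunE.
by apply/forallP => x; rewrite ffunE.
Qed.

Lemma expectation_integer_gaussian_le (f : height V -> R) (C : \bar R) Z :
  0 < Z -> gaussian_mass B A l setT = Z%:E -> (forall n, 0 <= f n) ->
  ('E_(integer_gaussian B A l)[f] <= C)%E <->
  forall N, (((\sum_(n <- box B N) f n * gaussian_weight A l n) / Z)%:E <= C)%E.
Proof.
move=> Z0 ZE f0.
(* A finite nonzero total mass keeps [mnormalize] away from its Dirac default. *)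
have PE n : integer_gaussian B A l [set n]%classic =
    (if n \in [set n : height V | vanishes_on B n]%classic
     then (gaussian_weight A l n / Z)%:E else 0%E).
  rewrite /integer_gaussian /= /mnormalize /= ZE eqe gt_eqF //= /gaussian_mass.
  case: ifPn => [/set_mem nB|/negP nB].
    rewrite (_ : _ `&` _ = [set n])%classic ?esum_set1 ?lee_fin ?expR_ge0 //.
    by apply/seteqP; split=> [m []|m ->].
  rewrite (_ : _ `&` _ = set0)%classic ?esum_set0 ?mul0e //.
  by apply/seteqP; split=> // m [/= -> nB']; apply: nB; rewrite inE.
rewrite unlock ge0_integral_height => [|n]; last by rewrite lee_fin.
rewrite (_ : esum _ _ = \esum_(n in [set n : height V | vanishes_on B n]%classic)
    (f n * gaussian_weight A l n / Z)%:E); last first.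
  rewrite [RHS]esum_mkcond; apply: eq_esum => n _; rewrite [X in (_ * X)%E]PE.
  by case: ifP => _; rewrite ?mule0 // -EFinM mulrA.
apply: iff_trans (esum_box_le _ _ _) _.
  by move=> n; rewrite divr_ge0 ?mulr_ge0 ?expR_ge0 // ltW.
by split=> fC N; have := fC N; rewrite mulr_suml.
Qed.

End Expectation.

(** * Monotonicity *)

Lemma gaussian_weight_box_cross (R : realType) (V : finType) (B : {set V})
    (A A' : V -> V -> R) (l l' : R) (v : {ffun V -> int} -> R) N :
  symmetric_mat A -> symmetric_mat A' -> posdef_off B A' ->
  qform_le_off B A' A -> 0 < l' -> l' <= l ->
  {morph v : n m / n + m} -> {morph v : n m / n - m} ->
  (\sum_(n <- box B N) v n ^+ 2 * gaussian_weight A l n) *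
  (\sum_(n <- box B N) gaussian_weight A' l' n) <=
  (\sum_(n <- box B (N + N)) v n ^+ 2 * gaussian_weight A' l' n) *
  (\sum_(n <- box B (N + N)) gaussian_weight A l n).
Proof.
move=> symA symA' posA' leA l'0 ll' vD vB.
(* Zeroing the rows and columns of [B] makes [q] nonnegative on all functions, as [psd_gram]
   requires. The 4 comes from inverting [a = n + m], [b = n - m]. *)
pose q x y := if (x \in B) || (y \in B) then 0 else (l * A x y - l' * A' x y) / 4.
have qE f : vanishes_on B f -> qform q f = (l * qform A f - l' * qform A' f) / 4.
  move=> fB; rewrite /qform !mulr_sumr -sumrB mulr_suml; apply: eq_bigr => z _.
  have -> : \sum_t q z t * f t =
     if z \in B then 0 else (l * (\sum_t A z t * f t) - l' * (\sum_t A' z t * f t)) / 4.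
    case: ifP => zB; first by rewrite big1 // => t _; rewrite /q zB mul0r.
    rewrite !mulr_sumr -sumrB mulr_suml; apply: eq_bigr => t _.
    by rewrite /q zB /=; case: ifP => [/fB ->|_]; ring.
  by case: ifP => [/fB ->|_]; ring.
have symq : symmetric_mat q by move=> z t; rewrite /q orbC symA symA'.
have q0 f : 0 <= qform q f.
  pose g z := if z \in B then 0 else f z.
  have gB : vanishes_on B g by move=> z zB; rewrite /g zB.
  have -> : qform q f = qform q g.
    apply: eq_bigr => z _.
    have -> : \sum_t q z t * f t = \sum_t q z t * g t.
      by apply: eq_bigr => t _; rewrite /q /g; case: (t \in B); rewrite ?orbT ?mul0r.
    rewrite /g; case: ifP => // zB.
    by rewrite mul0r big1 ?mulr0 // => t _; rewrite /q zB mul0r.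
  rewrite qE // divr_ge0 // subr_ge0.
  (* The middle term separates the two monotonicities, in the coupling constant and in the
     matrix. *)
  apply: (@le_trans _ _ (l * qform A' g)).
    by apply: ler_wpM2r => //; exact: (posdef_off_ge0 B A').
  by apply: ler_wpM2l; [exact: le_trans (ltW l'0) ll' | exact: leA].
have [r qr] := psd_gram q symq q0.
pose emb (n : {ffun V -> int}) z : R := (n z)%:~R.
pose L (f : V -> R) a := \sum_z f z * emb a z.
pose K a b := expR (\sum_(f <- r) L f a * L f b).
have KE a b : K a b = expR (bform q (emb a) (emb b)).
  congr expR; rewrite /bform; under [RHS]eq_bigr do rewrite mulr_sumr.
  under [RHS]eq_bigr do under eq_bigr do rewrite qr mulr_suml mulr_sumr.
  under [RHS]eq_bigr do rewrite exchange_big.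
  rewrite [RHS]exchange_big; apply: eq_bigr => f _.
  rewrite /L mulr_suml; apply: eq_bigr => z _; rewrite mulr_sumr.
  by apply: eq_bigr => t _; ring.
(* Since [a - b = 2 m], [bform q a b - qform q a / 2 - qform q b / 2 = - 2 * qform q m], which turns
   the weight of [l' A'] at [m] into that of [l A]. *)
pose u (a : {ffun V -> int}) : R :=
  v a * expR (- (l' / 4) * qform A' (emb a) - qform q (emb a) / 2).
apply: (weighted_sum_cross (box B N) (box B (N + N)) (box B (N + N))
  (gaussian_weight A l) (gaussian_weight A' l') v u K).
- exact: box_uniq.
- exact: box_uniq.
- exact: box_uniq.
- by apply: sub_box; rewrite leq_addr.
- exact: box_sumdiff.
- exact: box_sumdiff_inv.
- exact: boxN.
- by move=> n; exact: expR_ge0.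
- by move=> n; exact: expR_ge0.
- exact: psd_kernel_expR_gram.
move=> n m /box_vanishes_on nB /box_vanishes_on mB.
have embB (p : {ffun V -> int}) : vanishes_on B p -> vanishes_on B (emb p).
  by move=> pB z zB; rewrite /emb pB.
have embD : emb (n + m) = fun z => emb n z + 1 * emb m z.
  by apply/funext => z; rewrite /emb ffunE rmorphD mul1r.
have embN : emb (n - m) = fun z => emb n z + (-1) * emb m z.
  by apply/funext => z; rewrite /emb !ffunE rmorphB mulN1r.
have qm := qE _ (embB _ mB).
rewrite KE /u /gaussian_weight -!/(emb _) vD vB embD embN.
rewrite !qformD // bformDl !bformDr (bformC q _ _ symq) -!qformE.
have key e1 e2 e3 e4 e5 (c d : R) : e1 + e2 = e3 + e4 + e5 ->
    expR e1 * expR e2 * (c ^+ 2 - d ^+ 2) =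
    (c + d) * expR e3 * ((c - d) * expR e4) * expR e5.
  by move=> eE; rewrite -expRD eE !expRD; ring.
by apply: key; rewrite qm; field.
Qed.

Theorem corollaryC4 (R : realType) (V : finType) (B : {set V})
    (A A' : V -> V -> R) (l l' : R) :
  B != finset.set0 ->
  symmetric_mat A -> posdef_off B A ->
  symmetric_mat A' -> posdef_off B A' ->
  qform_le_off B A' A ->
  0 < l' -> l' <= l ->
  forall x y : V,
    ('E_(integer_gaussian B A l) [fun n => ((n x - n y) ^+ 2)%:~R]
     <= 'E_(integer_gaussian B A' l') [fun n => ((n x - n y) ^+ 2)%:~R])%E.
Proof.
move=> _ symA posA symA' posA' leA l'0 ll' x y.
have l0 : 0 < l by exact: lt_le_trans ll'.
have [Z Z0 [ZE Zsup]] := gaussian_mass_fin B A l symA posA l0.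
have [Z' Z'0 [Z'E Z'sup]] := gaussian_mass_fin B A' l' symA' posA' l'0.
pose f (n : height V) : R := ((n x - n y) ^+ 2)%:~R.
have f0 n : 0 <= f n by rewrite ler0z sqr_ge0.
pose v (n : {ffun V -> int}) : R := (n x - n y)%:~R.
have vD : {morph v : n m / n + m}.
  by move=> n m; rewrite /v !ffunE !rmorphB !rmorphD /=; ring.
have vB : {morph v : n m / n - m}.
  by move=> n m; rewrite /v !ffunE !rmorphB /=; ring.
have fE n : f n = v n ^+ 2 by rewrite /f rmorphXn.
have w0 n : 0 <= gaussian_weight A l n by exact: expR_ge0.
have w'0 n : 0 <= gaussian_weight A' l' n by exact: expR_ge0.
(* Bounding every box sum bounds the expectation, which leaves finite sums to compare. *)
apply/(expectation_integer_gaussian_le B A l f _ _ Z0 ZE f0) => N.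
have := iffLR (expectation_integer_gaussian_le B A' l' f _ _ Z'0 Z'E f0) (lexx _).
(* An infinite right-hand side is trivial, and minus infinity contradicts the bounds on its box
   sums. *)
case: expectation => [e'||] e'P; [|exact: leey|by have := e'P 0%N].
rewrite lee_fin ler_pdivrMr //.
have le_e'Z' K : \sum_(n <- box B K) f n * gaussian_weight A' l' n <= e' * Z'.
  by have := e'P K; rewrite lee_fin ler_pdivrMr.
have le_Z K : \sum_(n <- box B K) gaussian_weight A l n <= Z by exact: (iffLR (Zsup _)).
have fw0 C k n : 0 <= f n * gaussian_weight C k n.
  by rewrite mulr_ge0 // expR_ge0.
have mono (g : height V -> R) L K : (forall n, 0 <= g n) -> (L <= K)%N ->
    \sum_(n <- box B L) g n <= \sum_(n <- box B K) g n.
  by move=> g0 LK; apply: ler_sum_subset => //; [exact: box_uniq..|exact: sub_box].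
have sum0 (g : height V -> R) K : (forall n, 0 <= g n) -> 0 <= \sum_(n <- box B K) g n.
  by move=> g0; exact: sumr_ge0.
set a := \sum_(n <- _) _.
(* The main case divides by [a]; a zero [a] only needs the right-hand expectation to be
   nonnegative. *)
have := sum0 _ N (fw0 A l); rewrite -/a le_eqVlt => /predU1P[<-|a0].
  apply: mulr_ge0; last exact: ltW.
  rewrite -(ler_pM2r Z'0) mul0r.
  exact: le_trans (sum0 _ 0%N (fw0 A' l')) (le_e'Z' 0%N).
(* With [Z'] isolated, its supremum property reduces the claim to box sums. *)
rewrite -(ler_pM2r Z'0) -ler_pdivlMl //.
apply/Z'sup => M; rewrite ler_pdivlMl //.
(* The cross inequality has one radius for both left factors, so both boxes are enlarged to a common
   one. *)
pose K := maxn N M.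
have := gaussian_weight_box_cross R V B A A' l l' v K symA symA' posA' leA l'0 ll' vD vB.
under eq_bigr do rewrite -fE.
under [X in _ <= X * _ -> _]eq_bigr do rewrite -fE.
move=> cross; rewrite mulrAC; apply: le_trans (le_trans cross _).
  by apply: ler_pM; rewrite ?mono ?sum0 ?leq_maxl ?leq_maxr // ltW.
by apply: ler_pM; rewrite ?sum0.
Qed.
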